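(* Let $w=[x^\top,y^\top,z^\top]^\top$ be the unique solution of the double saddle point problem $\mathfrak{B}w=b$, let $L\in\mathbb{R}^{k\times l}$, and suppose $Lw\ne0$. Then the partial mixed condition number $\mathfrak{K}^{\infty}_{mix,\varphi}$ and the partial componentwise condition number $\mathfrak{K}^{\infty}_{com,\varphi}$ of $w$ with respect to $L$ satisfy $$\mathfrak{K}^{\infty}_{mix,\varphi}(\mathbf{H},b;L)\le\mathfrak{K}^{\infty,u}_{mix,\varphi}(\mathbf{H},b;L):=\frac{\left\||L\mathfrak{B}^{-1}|\,(|\mathcal{H}|+|b|)\right\|_\infty}{\|Lw\|_\infty}$$ and $$\mathfrak{K}^{\infty}_{com,\varphi}(\mathbf{H},b;L)\le\mathfrak{K}^{\infty,u}_{com,\varphi}(\mathbf{H},b;L):=\left\|\frac{|L\mathfrak{B}^{-1}|\,(|\mathcal{H}|+|b|)}{Lw}\right\|_\infty,$$ where $$\mathcal{H}=\begin{bmatrix} |A||x|+|B^\top||y| \\ |B||x|+|D||y|+|C^\top||z| \\ |C||y|+|E||z| \end{bmatrix}.$$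
   Context: Let $A\in\mathbb{R}^{n\times n}$, $B\in\mathbb{R}^{m\times n}$, $C\in\mathbb{R}^{p\times m}$, $D\in\mathbb{R}^{m\times m}$, $E\in\mathbb{R}^{p\times p}$, $l=n+m+p$, $b\in\mathbb{R}^{l}$, and $$\mathfrak{B}=\begin{bmatrix} A & B^\top & 0 \\ B & -D & C^\top \\ 0 & C & E \end{bmatrix},$$ which is assumed nonsingular throughout. The double saddle point problem (DSPP) is $\mathfrak{B}w=b$ with $w=[x^\top,y^\top,z^\top]^\top$, $x\in\mathbb R^n$, $y\in\mathbb R^m$, $z\in\mathbb R^p$. Notation: $\mathrm{vec}$ stacks the columns of a matrix; for a tuple of matrices $\mathrm{vec}(X_1,\dots,X_r)=[\mathrm{vec}(X_1)^\top,\dots,\mathrm{vec}(X_r)^\top]^\top$. $\odot$ is the entrywise product and $|X|$ the entrywise absolute value. Operations $\odot$, $|\cdot|$, $\ddagger$ are applied componentwise to tuples. For a vector or matrix $v$, $v^\ddagger$ has entries $1/v_i$ if $v_i\ne0$ and $1$ if $v_i=0$. The entrywise quotient of vectors is $\frac{u}{v}=v^\ddagger\odot u$. $\mathbf{1}_k$ is the all-ones vector in $\mathbb R^k$. Write $\mathbf{H}=(A,B,C,D,E)$. For $L\in\mathbb{R}^{k\times l}$ ($k\le l$) put $\varphi(\mathbf{H},b)=L\mathfrak{B}^{-1}b$. For $\xi_L\in\mathbb{R}^k$ consider $$\lim_{\epsilon\to0}\ \sup_{0<\|\mathrm{vec}(\mathbf{H}^\ddagger\odot\Delta\mathbf{H},\,b^\ddagger\odot\Delta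 b)\|_\infty\le\epsilon}\frac{\|\xi_L^\ddagger\odot(\varphi(\mathbf{H}+\Delta\mathbf{H},b+\Delta b)-\varphi(\mathbf{H},b))\|_\infty}{\|\mathrm{vec}(\mathbf{H}^\ddagger\odot\Delta\mathbf{H},\,b^\ddagger\odot\Delta b)\|_\infty},$$ where $\Delta\mathbf{H}=(\Delta A,\Delta B,\Delta C,\Delta D,\Delta E)$ and $\Delta b$ range over perturbations whose entries are zero wherever the corresponding entry of $\mathbf{H}$, respectively $b$, is zero. The partial mixed condition number $\mathfrak{K}^{\infty}_{mix,\varphi}(\mathbf{H},b;L)$ is this quantity with $\xi_L=\|Lw\|_\infty\mathbf{1}_k$, and the partial componentwise condition number $\mathfrak{K}^{\infty}_{com,\varphi}(\mathbf{H},b;L)$ is this quantity with $\xi_L=Lw$. *)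

(* Defs.v *)
From mathcomp Require Import all_boot all_order all_algebra.
From mathcomp Require Import all_classical all_reals all_analysis.
Export numFieldNormedType.Exports.

Set Implicit Arguments.
Unset Strict Implicit.
Unset Printing Implicit Defensive.

Import Order.TTheory GRing.Theory Num.Theory.

Local Open Scope classical_set_scope.
Local Open Scope ring_scope.

(* Throughout, `|v| is the library norm on matrices, the largest absolute value
   of an entry; on column vectors this is the infinity norm. The entrywise
   absolute value of a matrix is absmx. *)

Section Entrywise.
Variables (R : realType) (r s : nat).
Implicit Types X Y : 'M[R]_(r, s).

Definition hadamard X Y : 'M[R]_(r, s) := map2_mx *%R X Y.

Definition absmx X : 'M[R]_(r, s) := map_mx (fun t : R => `|t|) X.

Definition ddagger X : 'M[R]_(r, s) :=
  map_mx (fun t : R => if t == 0 then 1 else t^-1) X.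

Definition quotmx X Y : 'M[R]_(r, s) := hadamard (ddagger Y) X.

(* mxvec is row-major, so the transpositions give the stacking of columns. *)
Definition colvec X : 'cV[R]_(s * r) := (mxvec X^T)^T.

Definition supported_on X Y := forall i j, X i j = 0 -> Y i j = 0.

End Entrywise.

Section DSPP.
Variables (R : realType) (n m p : nat).

(* Tuples (A, B, C, D, E). *)
Definition dspp_blocks : Type :=
  ('M[R]_n * 'M[R]_(m, n) * 'M[R]_(p, m) * 'M[R]_m * 'M[R]_p)%type.

Implicit Types (H dH : dspp_blocks) (b db : 'cV[R]_(n + m + p)).

Definition add_blocks H dH : dspp_blocks :=
  let: (A, B, C, D, E) := H in let: (dA, dB, dC, dD, dE) := dH in
  (A + dA, B + dB, C + dC, D + dD, E + dE).

Definition hadamard_blocks H dH : dspp_blocks :=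
  let: (A, B, C, D, E) := H in let: (dA, dB, dC, dD, dE) := dH in
  (hadamard A dA, hadamard B dB, hadamard C dC, hadamard D dD, hadamard E dE).

Definition ddagger_blocks H : dspp_blocks :=
  let: (A, B, C, D, E) := H in
  (ddagger A, ddagger B, ddagger C, ddagger D, ddagger E).

Definition blocks_supported_on H dH :=
  let: (A, B, C, D, E) := H in let: (dA, dB, dC, dD, dE) := dH in
  [/\ supported_on A dA, supported_on B dB, supported_on C dC,
      supported_on D dD & supported_on E dE].

Definition colvec_data H b :=
  let: (A, B, C, D, E) := H in
  col_mx (colvec A) (col_mx (colvec B) (col_mx (colvec C)
    (col_mx (colvec D) (col_mx (colvec E) (colvec b))))).

Definition dspp_mx H : 'M[R]_(n + m + p) :=
  let: (A, B, C, D, E) := H in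
  block_mx (block_mx A B^T B (- D)) (col_mx 0 C^T) (row_mx 0 C) E.

Definition calH H (x : 'cV[R]_n) (y : 'cV[R]_m) (z : 'cV[R]_p) :
    'cV[R]_(n + m + p) :=
  let: (A, B, C, D, E) := H in
  col_mx
    (col_mx (absmx A *m absmx x + absmx B^T *m absmx y)
            (absmx B *m absmx x + absmx D *m absmx y + absmx C^T *m absmx z))
    (absmx C *m absmx y + absmx E *m absmx z).

Definition dspp_sol H b : 'cV[R]_(n + m + p) := invmx (dspp_mx H) *m b.

Section ConditionNumbers.
Variable k : nat.
Implicit Types (L : 'M[R]_(k, n + m + p)) (xi : 'cV[R]_k).

(* invmx is total (it returns its argument on a singular matrix). This does not
   affect the condition numbers below: when dspp_mx H is nonsingular, so are
   the perturbed matrices of all sufficiently small perturbations. *)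
Definition phi L H b : 'cV[R]_k := L *m invmx (dspp_mx H) *m b.

Definition pert_size H b dH db : R :=
  `|colvec_data (hadamard_blocks (ddagger_blocks H) dH)
                (hadamard (ddagger b) db)|.

Definition cond_quotients L xi H b (eps : R) : set (\bar R) :=
  [set q | exists dH db,
    [/\ blocks_supported_on H dH, supported_on b db,
        0 < pert_size H b dH db <= eps &
        q = (`|hadamard (ddagger xi)
                 (phi L (add_blocks H dH) (b + db) - phi L H b)|
              / pert_size H b dH db)%:E]].

Definition cond_number L xi H b : \bar R :=
  lim (ereal_sup (cond_quotients L xi H b eps) @[eps --> 0^'+]).

Definition K_mix L H b : \bar R :=
  cond_number L (const_mx `|L *m dspp_sol H b|) H b.

Definition K_com L H b : \bar R :=
  cond_number L (L *m dspp_sol H b) H b.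

(* The limit always exists in the extended reals, so that lim is meaningful. *)
Lemma is_cvg_cond_number L xi H b :
  cvg (ereal_sup (cond_quotients L xi H b eps) @[eps --> 0^'+]).
Proof.
apply: nondecreasing_at_right_is_cvge; near=> e => u v _ _ uv.
apply: ereal_sup_le => _ [dH [db [sH sb /andP[d0 du] ->]]].
by exists dH, db; split=> //; rewrite d0 (le_trans du).
Unshelve. all: by end_near. Qed.

End ConditionNumbers.
End DSPP.

(* Main.v *)
Require Import Defs.
From mathcomp Require Import all_boot all_order all_algebra.
From mathcomp Require Import all_classical all_reals all_analysis.
From mathcomp Require Import lra.
Import Order.TTheory GRing.Theory Num.Theory.
Local Open Scope ring_scope.

Set Implicit Arguments.
Unset Strict Implicit.
Unset Printing Implicit Defensive.

(** Write M for the double saddle point matrix and dM, db for a perturbation of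
    relative size d. Measuring the perturbation relative to the data means
    |dM| <= d |M| and |db| <= d |b| entrywise (lemx_pert_size): an entry that
    vanishes is not perturbed, and any other entry changes by at most d times
    its absolute value.

    If w' solves the perturbed system and e = w' - w, then
    e = M^-1 (db - dM w - dM e) (pert_sol_sub). Multiplying by L and taking
    entrywise absolute values gives (lemx_residual)
      |L e| <= d |L M^-1| (|M| |w| + |b|) + d |L M^-1| |M| |e|.
    The first term, divided by d, is the claimed bound, because |M| |w| is the
    vector calH, block by block (absmx_dspp_mul). The second term is of second
    order: with L replaced by the identity the same inequality bounds the norm
    of e by a constant times d, as soon as d is small enough for the coefficient
    of e on the right to be at most 1/2 (norm_pert_sol_sub). That smallness also
    makes M + dM invertible (unitmx_pert), so that the perturbed solution is the
    one appearing in phi.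

    Hence, for small t, every difference quotient with d <= t is at most the
    bound plus a constant times t, and letting t tend to 0 bounds the condition
    number for an arbitrary scaling vector xi (cond_number_le). The mixed and
    componentwise estimates are the cases where xi is constant equal to the norm
    of L w, and where xi = L w. *)

(** * Entrywise order and the maximum norm *)

Section EntrywiseOrder.
Variable R : realType.

Definition lemx r s (X Y : 'M[R]_(r, s)) := forall i j, X i j <= Y i j.

Lemma lemx_trans r s (Y X Z : 'M[R]_(r, s)) : lemx X Y -> lemx Y Z -> lemx X Z.
Proof. by move=> XY YZ i j; apply: le_trans (XY i j) (YZ i j). Qed.

Lemma lemxD r s (X Y X' Y' : 'M[R]_(r, s)) :
  lemx X X' -> lemx Y Y' -> lemx (X + Y) (X' + Y').
Proof. by move=> XX' YY' i j; rewrite !mxE lerD. Qed.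

Lemma lemx_block r1 r2 s1 s2 (X X' : 'M[R]_(r1, s1)) (Y Y' : 'M[R]_(r1, s2))
    (Z Z' : 'M[R]_(r2, s1)) (T T' : 'M[R]_(r2, s2)) :
  lemx X X' -> lemx Y Y' -> lemx Z Z' -> lemx T T' ->
  lemx (block_mx X Y Z T) (block_mx X' Y' Z' T').
Proof.
move=> hX hY hZ hT i j; rewrite /block_mx !mxE.
by case: fintype.split => ?; rewrite !mxE; case: fintype.split.
Qed.

Lemma lemx_mul2l r s t (X : 'M[R]_(r, s)) (Y Z : 'M[R]_(s, t)) :
  lemx Y Z -> lemx (absmx X *m Y) (absmx X *m Z).
Proof.
by move=> YZ i j; rewrite !mxE; apply: ler_sum => a _; rewrite mxE ler_wpM2l.
Qed.

Lemma lemx_mul2r r s t (X : 'M[R]_(s, t)) (Y Z : 'M[R]_(r, s)) :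
  lemx Y Z -> lemx (Y *m absmx X) (Z *m absmx X).
Proof.
by move=> YZ i j; rewrite !mxE; apply: ler_sum => a _; rewrite mxE ler_wpM2r.
Qed.

Lemma lemx_absD r s (X Y : 'M[R]_(r, s)) :
  lemx (absmx (X + Y)) (absmx X + absmx Y).
Proof. by move=> i j; rewrite !mxE ler_normD. Qed.

Lemma absmxN r s (X : 'M[R]_(r, s)) : absmx (- X) = absmx X.
Proof. by apply/matrixP => i j; rewrite !mxE normrN. Qed.

Lemma lemx_absM r s t (X : 'M[R]_(r, s)) (Y : 'M[R]_(s, t)) :
  lemx (absmx (X *m Y)) (absmx X *m absmx Y).
Proof.
move=> i j; rewrite !mxE (le_trans (ler_norm_sum _ _ _)) //.
by apply: ler_sum => a _; rewrite !mxE normrM.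
Qed.

Lemma le_entry_norm r s (X : 'M[R]_(r, s)) i j : `|X i j| <= `|X|.
Proof.
rewrite [leRHS]/Num.Def.normr/= mx_normrE.
by apply/bigmax_geP; right => /=; exists (i, j).
Qed.

Lemma norm_le_entries r s (X : 'M[R]_(r, s)) c :
  0 <= c -> (forall i j, `|X i j| <= c) -> `|X| <= c.
Proof.
move=> c0 Xc; rewrite /Num.Def.normr/= mx_normrE.
by apply: bigmax_le => // -[i j].
Qed.

(** The norm of Y appears on the right, rather than a bound on its entries, so
    that inequalities between vectors pass directly to norms; the hypothesis
    forces Y to be nonnegative. *)
Lemma le_norm r s (X Y : 'M[R]_(r, s)) : lemx (absmx X) Y -> `|X| <= `|Y|.
Proof.
move=> XY; apply: norm_le_entries => // i j.
have := XY i j; rewrite mxE => /le_trans; apply.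
by rewrite (le_trans (ler_norm _)) ?le_entry_norm.
Qed.

Lemma norm_absmx r s (X : 'M[R]_(r, s)) : `|absmx X| = `|X|.
Proof.
apply/eqP; rewrite eq_le [X in _ && X]le_norm ?andbT; last by move=> i j.
by apply: norm_le_entries => // i j; rewrite mxE normr_id le_entry_norm.
Qed.

(** Each entry of the product is a sum of s terms; the crude constant s is
    enough, since it never enters the first-order term. *)
Lemma norm_mulmx r s t (X : 'M[R]_(r, s)) (Y : 'M[R]_(s, t)) :
  `|X *m Y| <= s%:R * `|X| * `|Y|.
Proof.
apply: norm_le_entries => [|i j]; first by rewrite !mulr_ge0.
rewrite mxE (le_trans (ler_norm_sum _ _ _)) //.
rewrite -[s in s%:R]card_ord -mulrA mulr_natl -sumr_const.
by apply: ler_sum => a _; rewrite normrM ler_pM ?le_entry_norm.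
Qed.

Lemma norm_colvec r s (X : 'M[R]_(r, s)) i j : `|X i j| <= `|colvec X|.
Proof.
have := le_entry_norm (colvec X) (mxvec_index j i) 0.
by rewrite mxE mxvecE mxE.
Qed.

Lemma norm_col_mx r1 r2 s (X : 'M[R]_(r1, s)) (Y : 'M[R]_(r2, s)) c :
  `|col_mx X Y| <= c -> `|X| <= c /\ `|Y| <= c.
Proof.
move=> h; have c0 := le_trans (normr_ge0 _) h.
split; apply: norm_le_entries => // i j; apply: le_trans h.
  by have := le_entry_norm (col_mx X Y) (lshift r2 i) j; rewrite col_mxEu.
by have := le_entry_norm (col_mx X Y) (rshift r1 i) j; rewrite col_mxEd.
Qed.

End EntrywiseOrder.

(** * Relative perturbations of the data *)

Section Perturbation.
Variable R : realType.

(** Where X vanishes the support condition makes dX vanish too; elsewhere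
    ddagger divides by the entry of X, so the hypothesis bounds the relative
    error. *)
Lemma lemx_supported r s (X dX : 'M[R]_(r, s)) d :
  supported_on X dX -> `|colvec (hadamard (ddagger X) dX)| <= d ->
  lemx (absmx dX) (d *: absmx X).
Proof.
move=> sX hd i j; have := le_trans (norm_colvec _ i j) hd; rewrite !mxE.
case: eqP => [X0 _|/eqP X0]; first by rewrite X0 sX ?normr0 ?mulr0.
by rewrite normrM normfV mulrC ler_pdivrMr ?normr_gt0.
Qed.

Variables n m p : nat.
Implicit Types H dH : dspp_blocks R n m p.

Lemma dspp_mxD H dH : dspp_mx (add_blocks H dH) = dspp_mx H + dspp_mx dH.
Proof.
case: H dH => [[[[A B] C] D] E] [[[[dA dB] dC] dD] dE] /=.
by rewrite !add_block_mx add_col_mx add_row_mx !addr0 !linearD.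
Qed.

Lemma absmx_dspp H : let: (A, B, C, D, E) := H in
  absmx (dspp_mx H) =
  block_mx (block_mx (absmx A) (absmx B^T) (absmx B) (absmx D))
    (col_mx 0 (absmx C^T)) (row_mx 0 (absmx C)) (absmx E).
Proof.
case: H => [[[[A B] C] D] E].
have absmx0 r s : absmx (0 : 'M[R]_(r, s)) = 0.
  by apply/matrixP => i j; rewrite !mxE normr0.
rewrite /absmx /= !map_block_mx map_col_mx map_row_mx -!/(absmx _).
by rewrite absmxN !absmx0.
Qed.

(** The nonzero blocks of each block row of dspp_mx are exactly the ones listed
    in calH; the sign of the block - D disappears in the absolute value. *)
Lemma absmx_dspp_mul H x y z :
  absmx (dspp_mx H) *m absmx (col_mx (col_mx x y) z) = calH H x y z.
Proof.
case: H => [[[[A B] C] D] E]; rewrite (absmx_dspp (A, B, C, D, E)) /=.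
have absmx_col r1 r2 (u : 'cV[R]_r1) (v : 'cV[R]_r2) :
    absmx (col_mx u v) = col_mx (absmx u) (absmx v) by exact: map_col_mx.
rewrite !absmx_col !mul_block_col mul_col_mx mul_row_col.
by rewrite !mul0mx add_col_mx addr0 add0r.
Qed.

(** What pert_size measures: it is the least common factor of relative error on
    all entries of the data. Each block of dspp_mx dH inherits the estimate from
    its own data, B and C being used a second time through their transposes. *)
Lemma lemx_pert_size H dH (b db : 'cV_(n + m + p)) :
  blocks_supported_on H dH -> supported_on b db ->
  lemx (absmx (dspp_mx dH)) (pert_size H b dH db *: absmx (dspp_mx H)) /\
  lemx (absmx db) (pert_size H b dH db *: absmx b).
Proof.
case: H dH => [[[[A B] C] D] E] [[[[dA dB] dC] dD] dE] /= [sA sB sC sD sE] sb.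
set d := pert_size _ _ _ _; have := lexx d; rewrite {1}/d /pert_size /=.
case/norm_col_mx=> /(lemx_supported sA) hA.
case/norm_col_mx=> /(lemx_supported sB) hB.
case/norm_col_mx=> /(lemx_supported sC) hC.
case/norm_col_mx=> /(lemx_supported sD) hD.
case/norm_col_mx=> /(lemx_supported sE) hE /(lemx_supported sb) hb.
split=> //.
have tr r s (X Y : 'M[R]_(r, s)) :
    lemx (absmx X) (d *: absmx Y) -> lemx (absmx X^T) (d *: absmx Y^T).
  by move=> XY i j; have := XY j i; rewrite !mxE.
rewrite (absmx_dspp (dA, dB, dC, dD, dE)) (absmx_dspp (A, B, C, D, E)).
rewrite !scale_block_mx scale_col_mx scale_row_mx !scaler0.
apply: lemx_block => //; first by apply: lemx_block => //; exact: tr.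
- move=> i j; rewrite !mxE; case: fintype.split => a; first by rewrite lexx.
  exact: tr.
- by move=> i j; rewrite !mxE; case: fintype.split => a; first by rewrite lexx.
Qed.

End Perturbation.

(** * First-order bound for a perturbed linear system *)

Section LinearSystem.
Variables (R : realType) (N : nat).
Implicit Types (M dM : 'M[R]_N) (b db w : 'cV[R]_N) (d : R).

(** The matrix |M^-1| |M| of Bauer and Skeel, which governs the response to
    entrywise relative perturbations. *)
Definition cond_mx M := absmx (invmx M) *m absmx M.

Lemma lemx_mul_pert r s (X : 'M[R]_(r, N)) M dM (u : 'M[R]_(N, s)) d :
  lemx (absmx dM) (d *: absmx M) ->
  lemx (absmx (X *m (dM *m u))) (d *: (absmx X *m absmx M *m absmx u)).
Proof.
move=> hM; apply: lemx_trans (lemx_absM _ _) _.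
rewrite -mulmxA scalemxAr scalemxAl; apply: lemx_mul2l.
by apply: lemx_trans (lemx_absM _ _) _; apply: lemx_mul2r.
Qed.

Lemma norm_cond_mx M dM (u : 'cV[R]_N) d : 0 <= d ->
  lemx (absmx dM) (d *: absmx M) ->
  `|invmx M *m (dM *m u)| <= d * (N%:R * `|cond_mx M|) * `|u|.
Proof.
move=> d0 hM; apply: le_trans (le_norm (lemx_mul_pert (invmx M) u hM)) _.
rewrite normrZ ger0_norm // -mulrA ler_wpM2l //.
by rewrite (le_trans (norm_mulmx _ _)) // norm_absmx.
Qed.

(** A kernel vector u of M + dM satisfies u = - M^-1 dM u, and the right-hand
    side is strictly smaller in norm than u unless u = 0. *)
Lemma unitmx_pert M dM d : 0 <= d -> M \in unitmx ->
  lemx (absmx dM) (d *: absmx M) -> d * (N%:R * `|cond_mx M|) < 1 ->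
  M + dM \in unitmx.
Proof.
move=> d0 uM hM small; rewrite -unitmx_tr unitmxE unitfE.
apply/det0P => -[v v0 /(congr1 trmx)]; rewrite trmx_mul trmxK trmx0 mulmxDl.
move/(canRL (addrK _)); rewrite sub0r => /(congr1 (mulmx (invmx M))).
rewrite mulKmx // mulmxN => vE.
have u0 : 0 < `|v^T| by rewrite normr_gt0 -trmx0 (inj_eq trmx_inj).
have := norm_cond_mx v^T d0 hM; rewrite -normrN -vE leNgt => /negP; apply.
by rewrite gtr_pMl.
Qed.

(** The unknown error is kept on the right, multiplied by dM: the inverse of
    M + dM then never has to be estimated. *)
Lemma pert_sol_sub M dM b db w w' : M \in unitmx -> M *m w = b ->
  (M + dM) *m w' = b + db ->
  w' - w = invmx M *m (db - dM *m w - dM *m (w' - w)).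
Proof.
move=> uM <- h; have -> : db - dM *m w - dM *m (w' - w) = M *m (w' - w).
  have -> : db = (M + dM) *m w' - M *m w by rewrite h addrC addKr.
  by rewrite !mulmxBr mulmxDl opprB addrA subrK addrAC addrK.
by rewrite mulKmx.
Qed.

(** Taken with a general X because it is used twice: with X = M^-1 to see that
    the error is of order d, and with X = L M^-1 for the sharp bound. *)
Lemma lemx_residual r (X : 'M[R]_(r, N)) M dM b db w (e : 'cV[R]_N) d :
  lemx (absmx dM) (d *: absmx M) -> lemx (absmx db) (d *: absmx b) ->
  lemx (absmx (X *m (db - dM *m w - dM *m e)))
    (d *: (absmx X *m (absmx M *m absmx w + absmx b))
     + d *: (absmx X *m absmx M *m absmx e)).
Proof.
move=> hM hb; rewrite mulmxBr.
apply: lemx_trans (lemx_absD _ _) _; apply: lemxD; last first.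
  by rewrite absmxN; apply: lemx_mul_pert.
rewrite mulmxBr; apply: lemx_trans (lemx_absD _ _) _.
rewrite absmxN addrC mulmxDr scalerDr mulmxA; apply: lemxD.
  exact: lemx_mul_pert.
apply: lemx_trans (lemx_absM _ _) _.
by rewrite scalemxAr; apply: lemx_mul2l.
Qed.

(** The residual estimate with X = M^-1 bounds the norm of the error by a term
    of order d plus at most half of that same norm, which is then absorbed on
    the left. *)
Lemma norm_pert_sol_sub M dM b db w w' d : 0 <= d -> M \in unitmx ->
  lemx (absmx dM) (d *: absmx M) -> lemx (absmx db) (d *: absmx b) ->
  d * (N%:R * `|cond_mx M|) <= 2^-1 ->
  M *m w = b -> (M + dM) *m w' = b + db ->
  `|w' - w| <=
    2 * (d * `|absmx (invmx M) *m (absmx M *m absmx w + absmx b)|).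
Proof.
move=> d0 uM hM hb small wE w'E; set a := `|_ *m _|; set e := w' - w.
have eE : e = invmx M *m _ := pert_sol_sub uM wE w'E.
have e_le : `|e| <= d * a + d * (N%:R * `|cond_mx M|) * `|e|.
  rewrite {1}eE (le_trans (le_norm (lemx_residual (invmx M) w e hM hb))) //.
  rewrite (le_trans (ler_normD _ _)) // !normrZ ger0_norm // lerD //.
  rewrite -mulrA ler_wpM2l // (le_trans (norm_mulmx _ _)) //.
  by rewrite norm_absmx.
have := ler_wpM2r (normr_ge0 e) small; lra.
Qed.

End LinearSystem.

(** * Bounding the condition numbers *)

Section ConditionNumber.
Variables (R : realType) (n m p k : nat).
Implicit Types (H : dspp_blocks R n m p) (L : 'M[R]_(k, n + m + p)).

Lemma norm_hadamard r s (X Y : 'M[R]_(r, s)) : `|hadamard X Y| <= `|X| * `|Y|.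
Proof.
apply: norm_le_entries => [|i j]; first by rewrite mulr_ge0.
by rewrite mxE normrM ler_pM ?le_entry_norm.
Qed.

(** Valid for every scaling vector xi: the scaling only multiplies the entrywise
    first-order bound, and passes through the limit unchanged. *)
Lemma cond_number_le L xi H x y z b :
  let w := col_mx (col_mx x y) z in
  dspp_mx H \in unitmx -> dspp_mx H *m w = b ->
  (cond_number L xi H b <=
   `|hadamard (ddagger xi)
       (absmx (L *m invmx (dspp_mx H)) *m (calH H x y z + absmx b))|%:E)%E.
Proof.
move=> w uM wE; rewrite -absmx_dspp_mul -/w.
set M := dspp_mx H; set X := L *m invmx M; set g := ddagger xi.
set beta := `|hadamard g _|.
pose c := (n + m + p)%:R * `|cond_mx M|.
pose a := `|absmx (invmx M) *m (absmx M *m absmx w + absmx b)|.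
pose q := `|g| * ((n + m + p)%:R * `|absmx X *m absmx M|).
have c0 : 0 <= c by rewrite mulr_ge0.
have q0 : 0 <= q by rewrite !mulr_ge0.
(* The term 2 * d * a * q collects the second-order part: 2 * d * a bounds the
   error of the solution, and q its amplification by g and |X| |M|. *)
have quotient_le dH db (d := pert_size H b dH db) :
    blocks_supported_on H dH -> supported_on b db -> 0 < d ->
    d * c <= 2^-1 ->
    `|hadamard g (phi L (add_blocks H dH) (b + db) - phi L H b)| / d
    <= beta + 2 * d * a * q.
  move=> sH sb d0 small; have [hM hb] := lemx_pert_size sH sb.
  rewrite -/d -/M in hM hb.
  have uM' : M + dspp_mx dH \in unitmx.
    apply: (unitmx_pert (ltW d0) uM hM); apply: le_lt_trans small _; lra.
  rewrite /phi dspp_mxD -/M -/X -[L *m _ *m _]mulmxA.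
  set w' := invmx _ *m (b + db); rewrite -wE -/M mulmxA mulmxKV //.
  rewrite -mulmxBr.
  have w'E : (M + dspp_mx dH) *m w' = b + db by rewrite mulKVmx.
  have e_le := norm_pert_sol_sub (ltW d0) uM hM hb small wE w'E.
  rewrite -/a in e_le; rewrite ler_pdivrMr //.
  have -> : L *m (w' - w) =
      X *m (db - dspp_mx dH *m w - dspp_mx dH *m (w' - w)).
    by rewrite {1}(pert_sol_sub uM wE w'E) mulmxA.
  set e := w' - w in e_le *.
  have res := lemx_residual X w e hM hb.
  set V := absmx X *m (_ + _) in res beta *.
  set T := absmx X *m _ *m _ in res.
  have le1 : `|hadamard g (X *m (db - dspp_mx dH *m w - dspp_mx dH *m e))|
             <= `|d *: hadamard (absmx g) V + d *: hadamard (absmx g) T|.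
    apply: le_norm => i j; have := res i j; rewrite !mxE normrM => {}res.
    by rewrite (le_trans (ler_wpM2l _ res)) // mulrDr ![_ * (d * _)]mulrCA.
  apply: le_trans le1 _; rewrite (le_trans (ler_normD _ _)) //.
  rewrite !normrZ gtr0_norm // mulrDl lerD //.
    rewrite mulrC ler_wpM2r ?(ltW d0) //.
    apply: norm_le_entries => [|i j]; first exact: normr_ge0.
    by have := le_entry_norm (hadamard g V) i j; rewrite !mxE !normrM normr_id.
  rewrite [leRHS]mulrC ler_wpM2l ?(ltW d0) //.
  apply: le_trans (norm_hadamard _ _) _; rewrite norm_absmx.
  apply: (@le_trans _ _ (q * `|e|)).
    by rewrite -mulrA ler_wpM2l // (le_trans (norm_mulmx _ _)) // norm_absmx.
  by rewrite [leRHS]mulrC -[2 * d * a]mulrA ler_wpM2l.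
apply/lee_addgt0Pr => eps eps0.
apply: lime_le; first exact: is_cvg_cond_number.
have aq0 : 0 <= a * q by rewrite mulr_ge0 ?normr_ge0.
near=> t; apply: ge_ereal_sup => _ [dH [db [sH sb /andP[d0 dt] ->]]].
have t0 : 0 <= t := le_trans (ltW d0) dt.
rewrite lee_fin (le_trans (quotient_le _ _ sH sb d0 _)) //.
  (* c may vanish, hence the added 1 in the denominator; likewise below. *)
  have : t <= 2^-1 / (c + 1).
    by near: t; apply: nbhs_right_le; apply: divr_gt0; lra.
  rewrite ler_pdivlMr; last by lra.
  by have := ler_wpM2r c0 dt; lra.
have : t <= eps / (2 * (a * q) + 1).
  by near: t; apply: nbhs_right_le; apply: divr_gt0; lra.
rewrite ler_pdivlMr; last by lra.
by have := ler_wpM2r aq0 dt; lra.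
Unshelve. all: by end_near. Qed.

End ConditionNumber.

Theorem corollary3p2 (R : realType) (n m p k : nat)
    (A : 'M[R]_n) (B : 'M[R]_(m, n)) (C : 'M[R]_(p, m))
    (D : 'M[R]_m) (E : 'M[R]_p) (b : 'cV[R]_(n + m + p))
    (x : 'cV[R]_n) (y : 'cV[R]_m) (z : 'cV[R]_p)
    (L : 'M[R]_(k, n + m + p)) :
  let H : dspp_blocks R n m p := (A, B, C, D, E) in
  let w := col_mx (col_mx x y) z in
  let v := absmx (L *m invmx (dspp_mx H)) *m (calH H x y z + absmx b) in
  (k <= n + m + p)%N ->
  dspp_mx H \in unitmx ->
  dspp_mx H *m w = b ->
  L *m w != 0 ->
  (K_mix L H b <= (`|v| / `|L *m w|)%:E)%E /\
  (K_com L H b <= `|quotmx v (L *m w)|%:E)%E.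
Proof.
move=> H w v _ uM wE Lw0.
have sol : dspp_sol H b = w by rewrite /dspp_sol -wE mulKmx.
rewrite /K_mix /K_com sol; split; last exact: cond_number_le.
have -> : `|v| / `|L *m w| = `|hadamard (ddagger (const_mx `|L *m w|)) v|.
  have -> : hadamard (ddagger (const_mx `|L *m w|)) v = `|L *m w|^-1 *: v.
    by apply/matrixP => i j; rewrite !mxE normr_eq0 (negbTE Lw0).
  by rewrite normrZ normfV normr_id mulrC.
exact: cond_number_le.
Qed.
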